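(* Let $n\ge 0$. For every Cayley tree $T$ labelled with $[n]_0$ and every parking function $\pi$ of length $n$ consider the hexads $$(\mathrm{Rec}(T),\ \mathrm{wait}(T),\ \mathrm{psa}(T),\ \deg_\circ(T),\ \mathrm{chseq}(T),\ \mathrm{ord}(T))\quad\text{and}\quad(\mathrm{Rec}(\pi),\ \mathrm{probes}(\pi),\ \mathrm{lucky}(\pi),\ \mathrm{ones}(\pi),\ \mathrm{mult}(\pi),\ \mathrm{len}(\pi)).$$ These hexads are equidistributed: for every possible value $v$, the number of Cayley trees $T$ labelled with $[n]_0$ whose first hexad equals $v$ equals the number of parking functions $\pi$ of length $n$ whose second hexad equals $v$.
   Context: $[n]=\{1,\dots,n\}$, $[n]_0=\{0,1,\dots,n\}$. A Cayley tree labelled with $[n]_0$ is a tree on vertex set $[n]_0$ rooted at $0$ (the root, also written $\circ$); $f_T:[n]\to[n]_0$ denotes its parent map. A non-root vertex $k$ is a record of $T$ if $k$ is the largest label on the path from $k$ to the root; $\mathrm{Rec}(T)$ is the set of records. The weary permutation $\omega_T$ of $T$: run priority-first search from $0$ (at each step visit the smallest unvisited vertex adjacent to an already visited vertex); $\omega_T(i)$ is the $i$-th non-root vertex visited, and $\omega_T(0)=0$. The priority tree $\mathrm{pt}(T)$ is the tree obtained from $T$ by relabelling each vertex $v$ as $\omega_T^{-1}(v)$. Statistics on $T$: $\mathrm{ord}(T)=n$; $\deg_\circ(T)$ = number of children of the root; $\mathrm{chseq}(T)=(\tau_0,\dots,\tau_n)$ where $\tau_i$ is the number of vertices of $T$ (root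 included) with exactly $i$ children; $\mathrm{wait}(T)=\sum_{i=1}^n (i-f_{\mathrm{pt}(T)}(i))$; $\mathrm{psa}(T)$ = number of $i\in[n]$ with $f_{\mathrm{pt}(T)}(i)=i-1$. A parking function of length $n$ is a sequence $\pi=(a_1,\dots,a_n)$ with $a_i\in[n]$ such that, when cars $1,2,\dots,n$ enter in this order a street with spots $1,\dots,n$ and car $i$ parks in the first unoccupied spot $j\ge a_i$, every car parks. $\omega_\pi(j)$ denotes the car parked in spot $j$ (the bird's eye permutation). $\mathrm{Rec}(\pi)$ is the set of left-to-right maxima of the word $\omega_\pi(1)\omega_\pi(2)\cdots\omega_\pi(n)$. Statistics: $\mathrm{len}(\pi)=n$; $\mathrm{lucky}(\pi)$ = number of cars parking in their preferred spot; the displacement $\mathrm{dis}(\pi)$ is the total number of failed attempts (sum over cars of final spot minus preferred spot) and $\mathrm{probes}(\pi)=\mathrm{dis}(\pi)+n$; $\mathrm{ones}(\pi)$ = number of $i$ with $a_i=1$; $\mathrm{mult}(\pi)=(\mu_0,\dots,\mu_n)$ where $\mu_i$ is the number of elements of $[n+1]$ appearing exactly $i$ times in $\pi$. *)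

(* Defs.v *)
From HB Require Import structures.
From mathcomp Require Import all_boot all_fingroup.

Set Implicit Arguments.
Unset Strict Implicit.
Unset Printing Implicit Defensive.

(* A simple graph on V is its set of edges, an edge being a 2-element set. *)
Section Graph.
Variable V : finType.
Implicit Type E : {set {set V}}.

Definition adj E : rel V := fun x y => [set x; y] \in E.

(* A cycle of length 2 only goes back and forth along one edge. Lengths above
   #|V| are impossible for a cycle without repeated vertices. *)
Definition acyclic E : bool :=
  [forall k : 'I_#|V|.+1, forall c : k.-tuple V,
     ucycleb (adj E) c ==> (k <= 2)].

Definition is_tree E : bool :=
  [&& [forall e : {set V} in E, #|e| == 2],
      [forall x, forall y, connect (adj E) x y] & acyclic E].

Lemma adj_sym E : symmetric (adj E).
Proof. by move=> x y; rewrite /adj setUC. Qed.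

Definition relabel (s : {perm V}) E : {set {set V}} :=
  [set s @: e | e : {set V} in E].

Lemma adj_relabel (s : {perm V}) E x y :
  adj (relabel s E) (s x) (s y) = adj E x y.
Proof.
have sxy : s @: [set x; y] = [set s x; s y] by rewrite imsetU !imset_set1.
by rewrite /adj -sxy mem_imset //; apply: imset_inj; apply: perm_inj.
Qed.

Lemma relabel_is_tree (s : {perm V}) E :
  is_tree E -> is_tree (relabel s E).
Proof.
case/and3P=> /'forall_implyP cE /forallP connE /forallP acE; apply/and3P; split.
- apply/'forall_implyP=> _ /imsetP[e eE ->].
  by rewrite card_imset ?cE //; apply: perm_inj.
- apply/forallP=> x; apply/forallP=> y.
  rewrite -(permKV s x) -(permKV s y).
  have /forallP/(_ ((s^-1)%g y))/connectP[p pp ->] := connE ((s^-1)%g x).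
  elim: p ((s^-1)%g x) pp => [|z p IHp] w /=; first by rewrite connect0.
  case/andP=> wz /IHp; apply: connect_trans; apply: connect1.
  by rewrite adj_relabel.
apply/forallP=> k; apply/forallP=> c; apply/implyP=> /andP[cc uc].
have /forallP/(_ (map_tuple (s^-1)%g c))/implyP := acE k; apply.
apply/andP; split; last by rewrite map_inj_uniq //; apply: perm_inj.
rewrite cycle_map; apply: sub_cycle cc => x y /=.
by rewrite -{1}(permKV s x) -{1}(permKV s y) adj_relabel.
Qed.

End Graph.

Section CayleyTree.
Variable n : nat.

(* The vertex set [n]_0 is 'I_n.+1 with its literal labels, the root ord0. *)
Record cayley_tree := CayleyTree {
  edges :> {set {set 'I_n.+1}};
  edges_tree : is_tree edges }.

HB.instance Definition _ := [isSub for edges].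
HB.instance Definition _ := [Finite of cayley_tree by <:].

Implicit Type T : cayley_tree.

Lemma tree_connect T x y : connect (adj T) x y.
Proof. by have /and3P[_ /forallP/(_ x)/forallP/(_ y)] := edges_tree T. Qed.

Lemma root_path_exists T (k : 'I_n.+1) :
  exists p, [&& path (adj T) k p, uniq (k :: p) & last k p == ord0].
Proof.
have /connectP[p pp ->] := tree_connect T k ord0.
by case/shortenP: pp => q qq uq _; exists q; rewrite qq uq eqxx.
Qed.

(* The path from k to the root, without its initial vertex k. *)
Definition root_path T (k : 'I_n.+1) : seq 'I_n.+1 :=
  xchoose (root_path_exists T k).

(* The root gets the junk value ord0. *)
Definition parent T (k : 'I_n.+1) : 'I_n.+1 := head ord0 (root_path T k).

Definition children T (v : 'I_n.+1) : {set 'I_n.+1} :=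
  [set k | (k != ord0) && (parent T k == v)].

Definition tree_Rec T : {set 'I_n.+1} :=
  [set k | (k != ord0) && all (fun j : 'I_n.+1 => j <= k) (root_path T k)].

(* enum 'I_n.+1 is increasing, so that head picks the smallest vertex. *)
Definition pfs_next T (s : seq 'I_n.+1) : 'I_n.+1 :=
  head ord0 [seq v <- enum 'I_n.+1 | (v \notin s) && has (adj T v) s].

Definition pfs T (m : nat) : seq 'I_n.+1 :=
  iter m (fun s => rcons s (pfs_next T s)) [:: ord0].

Lemma size_pfs T m : size (pfs T m) = m.+1.
Proof. by elim: m => //= m IHm; rewrite size_rcons IHm. Qed.

Lemma pfs_nextP T (s : seq 'I_n.+1) :
    ord0 \in s -> size s <= n ->
  (pfs_next T s \notin s) && has (adj T (pfs_next T s)) s.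
Proof.
move=> s0 sn; rewrite /pfs_next.
case E: [seq _ <- _ | _] => [|v r]; last first.
  by move=> /=; have := mem_head v r; rewrite -E mem_filter => /andP[].
have clos : closed (adj T) (mem s).
  apply: intro_closed => [|x y xy xs]; first exact/sym_connect_sym/adj_sym.
  apply: contraFT (in_nil y) => ys; rewrite -E mem_filter mem_enum ys andbT.
  by apply/hasP; exists x; rewrite // adj_sym.
have all_s : {subset 'I_n.+1 <= s}.
  by move=> x _; rewrite -(closed_connect clos (tree_connect T ord0 x)).
have: #|'I_n.+1| <= size s.
  by rewrite cardE uniq_leq_size ?enum_uniq // => x _; apply: all_s.
by rewrite card_ord ltnNge sn.
Qed.

Lemma uniq_pfs T m : m <= n -> (ord0 \in pfs T m) && uniq (pfs T m).
Proof.
elim: m => //= m IHm mn; have /andP[m0 um] := IHm (ltnW mn).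
rewrite mem_rcons inE m0 orbT rcons_uniq um andbT /=.
by have /andP[] := @pfs_nextP T _ m0 (leq_trans (eq_leq (size_pfs T m)) mn).
Qed.

Lemma weary_inj T : injective (fun i : 'I_n.+1 => nth ord0 (pfs T n) i).
Proof.
move=> i j /eqP; have /andP[_ u] := uniq_pfs T (leqnn n).
by rewrite nth_uniq ?size_pfs // => /eqP/val_inj.
Qed.

Definition weary T : {perm 'I_n.+1} := perm (@weary_inj T).

Definition priority_tree T : cayley_tree :=
  CayleyTree (relabel_is_tree (weary T)^-1%g (edges_tree T)).

Definition tree_ord T : nat := n.

Definition deg_root T : nat := #|children T ord0|.

Definition chseq T : (n.+1).-tuple nat :=
  [tuple #|[set v | #|children T v| == i]| | i < n.+1].

(* The parent of a vertex is visited before it, so that labels increase away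
   from the root in the priority tree and the subtraction is never truncated. *)
Definition wait T : nat :=
  \sum_(i : 'I_n.+1 | i != ord0) (i - parent (priority_tree T) i).

Definition psa T : nat :=
  #|[set i : 'I_n.+1 |
      (i != ord0) && (parent (priority_tree T) i == i.-1 :> nat)]|.

End CayleyTree.

Section ParkingFunction.
Variable n : nat.

(* Cars, spots and preferences in [n] are shifted down by one, to 'I_n. *)

(* s lists the spots of the cars that have already entered, None standing for
   a car that left without parking; enum 'I_n is increasing. *)
Definition park (s : seq (option 'I_n)) (a : 'I_n) : option 'I_n :=
  ohead [seq j : 'I_n <- enum 'I_n | (a <= j) && (Some j \notin s)].

Definition outcome (a : seq 'I_n) : seq (option 'I_n) :=
  foldl (fun s x => rcons s (park s x)) [::] a.

Definition is_parking (a : n.-tuple 'I_n) : bool := None \notin outcome a.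

Record parking_function := ParkingFunction {
  prefs :> n.-tuple 'I_n;
  prefs_parking : is_parking prefs }.

HB.instance Definition _ := [isSub for prefs].
HB.instance Definition _ := [Finite of parking_function by <:].

Implicit Type p : parking_function.

Lemma size_outcome a : size (outcome a) = size a.
Proof.
elim/last_ind: a => // a x IHa.
by rewrite /outcome foldl_rcons !size_rcons -/(outcome a) IHa.
Qed.

Lemma outcome_uniq a : None \notin outcome a -> uniq (outcome a).
Proof.
elim/last_ind: a => // a x IHa.
rewrite /outcome foldl_rcons -/(outcome a) mem_rcons inE negb_or rcons_uniq.
case/andP=> parked /IHa->; rewrite andbT.
move: parked; rewrite /park; case E: [seq _ <- _ | _] => [|j r] //= _.
have := mem_head j r.
by rewrite -E mem_filter => /andP[/andP[]].
Qed.

(* No entry of the outcome of a parking function is None, so that the default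
   value given to odflt is irrelevant. *)
Definition spot_fun p (i : 'I_n) : 'I_n :=
  odflt (tnth p i) (nth None (outcome p) i).

Lemma spot_inj p : injective (spot_fun p).
Proof.
have spotE i : Some (spot_fun p i) = nth None (outcome p) i.
  rewrite /spot_fun; case E: (nth _ _ _) => [//|].
  have /negP[] := prefs_parking p.
  by rewrite -E mem_nth // size_outcome size_tuple.
have sz : size (outcome p) = n by rewrite size_outcome size_tuple.
have u := outcome_uniq (prefs_parking p).
move=> i j ij.
have /eqP: Some (spot_fun p i) = Some (spot_fun p j) by rewrite ij.
by rewrite !spotE (nth_uniq _ _ _ u) ?sz // => /eqP/val_inj.
Qed.

Definition spot p : {perm 'I_n} := perm (@spot_inj p).

Definition birds_eye p : {perm 'I_n} := (spot p)^-1%g.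

(* lift ord0 sends the shifted label of a car back to its label in [n]. *)
Definition parking_Rec p : {set 'I_n.+1} :=
  [set lift ord0 (birds_eye p j) | j : 'I_n &
     [forall i : 'I_n, (i < j) ==> (birds_eye p i < birds_eye p j)]].

Definition len p : nat := n.

Definition lucky p : nat := #|[set i | spot p i == tnth p i]|.

Definition dis p : nat := \sum_(i < n) (spot p i - tnth p i).

Definition probes p : nat := dis p + n.

Definition ones p : nat := #|[set i | tnth p i == 0 :> nat]|.

(* Here j : 'I_n.+1 stands for the element j + 1 of [n + 1]. *)
Definition mult p : (n.+1).-tuple nat :=
  [tuple #|[set j : 'I_n.+1 | count (fun a : 'I_n => a == j :> nat) p == i]|
   | i < n.+1].

End ParkingFunction.

Definition hexad (n : nat) : Type :=
  {set 'I_n.+1} * nat * nat * nat * (n.+1).-tuple nat * nat.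

Definition tree_hexad (n : nat) (T : cayley_tree n) : hexad n :=
  (tree_Rec T, wait T, psa T, deg_root T, chseq T, tree_ord T).

Definition parking_hexad (n : nat) (p : parking_function n) : hexad n :=
  (parking_Rec p, probes p, lucky p, ones p, mult p, len p).

(* Main.v *)
Require Import Defs.
From mathcomp Require Import all_boot all_fingroup.

(** A parking function is determined by its bird's eye permutation w and by the
preference b_j of the car parked in spot j. The pair (w, b) occurs exactly when
b_j <= j and every car in the spots b_j, ..., j - 1 came before car w j, i.e.
w i < w j whenever b_j <= i < j. Similarly, a Cayley tree is determined by its
weary permutation w and the parent map f of its priority tree, and (w, f)
occurs exactly when f_j < j and priority-first search prefers w i to the
already available w j whenever f_j < i < j. So b_j = f_j + 1 defines a
bijection that preserves w. The statistics other than records are read off f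
and b. The records of a tree are the left-to-right maxima of w: if w i > w j is
visited before w j, then either w i is an ancestor of w j, or when w i was
visited an ancestor of w j larger than w i was waiting. *)

Set Implicit Arguments.
Unset Strict Implicit.
Unset Printing Implicit Defensive.

(** [enum 'I_n] is increasing and filtering keeps it so, hence the head of the filtered list is its
    minimum. This serves both the search for the next vertex and the search for a free spot. *)
Lemma ohead_filter_enum_ordP n (P : pred 'I_n) j :
  ohead [seq i <- enum 'I_n | P i] = Some j <->
  P j /\ forall i, P i -> j <= i.
Proof.
have min h t : [seq i <- enum 'I_n | P i] = h :: t ->
    P h /\ forall i, P i -> h <= i.
  move=> E; have := mem_head h t; rewrite -E mem_filter => /andP[Ph _].
  split=> // i Pi.
  have: sorted (relpre val leq) [seq i <- enum 'I_n | P i].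
    apply: sorted_filter; first by move=> ? ? ?; apply: leq_trans.
    by rewrite -sorted_map val_enum_ord iota_sorted.
  have: i \in [seq i <- enum 'I_n | P i] by rewrite mem_filter Pi mem_enum.
  rewrite E inE => /predU1P[-> //|it] /= /order_path_min.
  by move=> /(_ (fun _ _ _ => @leq_trans _ _ _))/allP/(_ i it).
case E: [seq _ <- _ | _] => [|h t] /=; split=> //.
- by case=> Pj _; have := in_nil j; rewrite -E mem_filter Pj mem_enum.
- by case=> <-; apply: min E.
case=> Pj jmin; have [Ph hmin] := min h t E; congr Some; apply/val_inj/eqP.
by rewrite eqn_leq hmin // jmin.
Qed.

(** * Uniqueness of simple paths in acyclic graphs *)

Section AcyclicGraph.
Variables (V : finType) (E : {set {set V}}).
Hypothesis acE : acyclic E.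

(** The lengths quantified in [acyclic] suffice, since a sequence without repetition has at most
    [#|V|] entries. *)
Lemma acyclic_ucycle c : ucycle (adj E) c -> size c <= 2.
Proof.
move=> cc; have szc : size c < #|V|.+1.
  by rewrite ltnS -(card_uniqP (ucycle_uniq cc)) max_card.
by have /forallP/(_ (Ordinal szc))/forallP/(_ (in_tuple c))/implyP := acE; apply.
Qed.

(* Two simple paths that part at x meet again, and the first meeting point
   closes a simple cycle of length at least 3 through x. *)
Lemma acyclic_path_unique x p q :
    path (adj E) x p -> path (adj E) x q -> uniq (x :: p) -> uniq (x :: q) ->
  last x p = last x q -> p = q.
Proof.
elim: p x q => [|a p IHp] x [|b q] //.
- move=> _ _ _ /andP[/negP xq _] /= xl; case: xq.
  by rewrite {1}xl mem_last.
- move=> _ _ /andP[/negP xp _] _ /= xl; case: xp.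
  by rewrite -{1}xl mem_last.
move=> pp pq up uq ll.
have [ab | nab] := eqVneq a b.
  move: pp pq up uq ll; rewrite -{}ab /= => /andP[_ pp] /andP[_ pq].
  move=> /andP[_ up] /andP[_ uq] ll; congr (_ :: _).
  exact: IHp pp pq up uq ll.
have hasz : has (mem (b :: q)) (a :: p).
  apply/hasP; exists (last x (a :: p)); first exact: (mem_last a p).
  by rewrite ll; apply: (mem_last b q).
have [z [r [r2 [Ep zq rNq]]]] : exists z r r2,
    [/\ a :: p = rcons r z ++ r2, z \in b :: q & ~~ has (mem (b :: q)) r].
  by case: (split_find hasz) => z r r2; exists z, r, r2.
have [t [t2 Eq]] : exists t t2, b :: q = rcons t z ++ t2.
  by case/path.splitP: zq => t t2; exists t, t2.
have cyc : path.cycle (adj E) (x :: r ++ z :: rev t).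
  rewrite /= rcons_cat rcons_cons -cat_rcons cat_path last_rcons.
  move: pp pq; rewrite Ep Eq !cat_path => /andP[-> _] /andP[+ _] /=.
  rewrite -rev_cons -(belast_rcons x t z) -{2}(last_rcons x t z) rev_path.
  by apply: sub_path => u v; rewrite adj_sym.
have uc : uniq (x :: r ++ z :: rev t).
  have /andP[xt ut] : uniq (x :: z :: rev t).
    rewrite -(rev_rcons t z) cons_uniq mem_rev rev_uniq -cons_uniq.
    by move: uq; rewrite Eq -cat_cons cat_uniq => /andP[].
  have ur : uniq (x :: r).
    by move: up; rewrite Ep -cats1 -catA -cat_cons cat_uniq => /andP[].
  rewrite -cat_cons cat_uniq ur [uniq (z :: _)]ut andbT; apply/hasPn=> y yt.
  rewrite inE negb_or; apply/andP; split; first by apply: contraNneq xt => <-.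
  apply: contra rNq => yr; apply/hasP; exists y => //=.
  by rewrite Eq mem_cat mem_rcons inE -mem_rev -in_cons yt.
(* A length of at most 2 forces [r] and [t] to be empty, so [a] and [b] are both [z], against
   [nab]. *)
have /acyclic_ucycle : ucycle (adj E) (x :: r ++ z :: rev t) by rewrite /ucycle cyc.
rewrite /= size_cat /= size_rev addnS !ltnS leqn0 addn_eq0.
case/andP=> /nilP r0 /nilP t0; move: Ep Eq nab; rewrite {}r0 {}t0 => -[-> _] [-> _].
by rewrite eqxx.
Qed.

End AcyclicGraph.

(** * Root paths and parent maps of trees *)

Section Tree.
Variable n : nat.
Implicit Types (T : cayley_tree n) (k x y : 'I_n.+1).

Lemma root_pathP T k :
  [/\ path (adj T) k (root_path T k), uniq (k :: root_path T k)
    & last k (root_path T k) = ord0].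
Proof. by have /and3P[? ? /eqP] := xchooseP (root_path_exists T k). Qed.

Lemma root_path_unique T k p :
    path (adj T) k p -> uniq (k :: p) -> last k p = ord0 ->
  root_path T k = p.
Proof.
move=> pp up lp; have [pr ur lr] := root_pathP T k.
have /and3P[_ _ acT] := edges_tree T.
by apply: (acyclic_path_unique acT pr pp ur up); rewrite lr lp.
Qed.

Lemma root_path0 T : root_path T ord0 = [::].
Proof. exact: root_path_unique. Qed.

Lemma root_pathE T k :
  k != ord0 -> root_path T k = parent T k :: root_path T (parent T k).
Proof.
move=> k0; have := root_pathP T k; rewrite /parent.
case: (root_path T k) => [[_ _ /= k_0]|a p [/= /andP[_ pp] /andP[_ up] lp]].
  by rewrite k_0 eqxx in k0.
by rewrite (root_path_unique pp).
Qed.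

Lemma parent0 T : parent T ord0 = ord0.
Proof. by rewrite /parent root_path0. Qed.

Lemma adj_neq T x y : adj T x y -> x != y.
Proof.
have /and3P[/'forall_implyP cT _ _] := edges_tree T.
by move=> /cT; rewrite cards2; case: (x != y).
Qed.

Lemma adj_parent T k : k != ord0 -> adj T k (parent T k).
Proof.
by move=> k0; have [+ _ _] := root_pathP T k; rewrite root_pathE // => /andP[].
Qed.

(** If [y] is off the root path of [x], prepending [x] to that path gives the root path of [y].
    Otherwise the segment from [x] to [y] and the edge back form a cycle, necessarily of length 2,
    so [y] directly follows [x]. *)
Lemma adj_parentE T x y :
  adj T x y = (x != ord0) && (parent T x == y) || (y != ord0) && (parent T y == x).
Proof.
apply/idP/idP => [xy|/orP[]/andP[z0 /eqP<-]]; last 2 first.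
- exact: adj_parent.
- by rewrite adj_sym adj_parent.
apply/orP.
have [px ux lx] := root_pathP T x; have xNy := adj_neq xy.
have [yx | yNx] := boolP (y \in root_path T x); last first.
  right; have E : root_path T y = x :: root_path T x.
    apply: root_path_unique => //=; first by rewrite adj_sym xy.
    by rewrite -[(x \notin _) && _]/(uniq (x :: _)) ux inE negb_or yNx eq_sym xNy.
  rewrite /parent E eqxx andbT; apply: contra_eq_neq E => ->.
  by rewrite root_path0.
left; have [p1 [p2 Ep]] : exists p1 p2, root_path T x = rcons p1 y ++ p2.
  by case/path.splitP: yx => p1 p2; exists p1, p2.
have acT : acyclic T by case/and3P: (edges_tree T).
have /(acyclic_ucycle acT) : ucycle (adj T) (x :: rcons p1 y).
  move: px ux; rewrite Ep cat_path -cat_cons cat_uniq => /andP[pp _] /andP[up _].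
  by rewrite /ucycle up /= rcons_path pp last_rcons adj_sym xy.
rewrite /= size_rcons !ltnS leqn0 => /nilP p10; rewrite {}p10 /= in Ep.
rewrite /parent Ep eqxx andbT; apply: contra_eq_neq Ep => ->.
by rewrite root_path0.
Qed.

Lemma parent_inj T T' :
  (forall k, k != ord0 -> parent T k = parent T' k) -> T = T'.
Proof.
move=> pTT'; have adjTT' x y : adj T x y = adj T' x y.
  rewrite !adj_parentE; congr (_ || _).
    by have [//|x0] := eqVneq x ord0; rewrite pTT'.
  by have [//|y0] := eqVneq y ord0; rewrite pTT'.
apply/val_inj/setP => e /=.
have card2 T0 : e \in edges T0 -> exists x y, e = [set x; y].
  have /and3P[/'forall_implyP cT0 _ _] := edges_tree T0.
  by move=> /cT0 /cards2P[x [y [_ ->]]]; exists x, y.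
apply/idP/idP => eT; have [x [y exy]] := card2 _ eT; move: eT.
  by rewrite exy -/(adj T x y) adjTT'.
by rewrite exy -/(adj T' x y) -adjTT'.
Qed.

Lemma parent_relabel T T' (s : {perm 'I_n.+1}) k :
    s ord0 = ord0 -> edges T' = relabel s T ->
  parent T' (s k) = s (parent T k).
Proof.
move=> s0 ET'; rewrite /parent; have [pk uk lk] := root_pathP T k.
rewrite (_ : root_path T' (s k) = map s (root_path T k)).
  (* On an empty path both heads are the default [ord0], which [s] fixes. *)
  by case: (root_path T k) => /=.
apply: root_path_unique; last by rewrite last_map lk.
  rewrite path_map; apply: sub_path pk => x y /=.
  by rewrite ET' adj_relabel.
by rewrite -map_cons map_inj_uniq //; apply: perm_inj.
Qed.

(** * Construction of a tree from a rank-decreasing parent map *)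

Section TreeOfParent.
Variables (f : 'I_n.+1 -> 'I_n.+1) (r : 'I_n.+1 -> nat).
Hypothesis rf : forall k, k != ord0 -> r (f k) < r k.

Let E := [set [set k; f k] | k in predC1 ord0].

Let adjE x y : adj E x y = (x != ord0) && (f x == y) || (y != ord0) && (f y == x).
Proof.
apply/imsetP/orP => [[k k0]|[] /andP[z0 /eqP <-]]; last 2 first.
- by exists x.
- by exists y; rewrite // setUC.
have fk : f k != k by apply: contraTneq (rf k0) => ->; rewrite ltnn.
move=> /setP exy; have := exy k; have := exy (f k).
rewrite !inE !eqxx orbT /= ![_ == x]eq_sym ![_ == y]eq_sym.
case/orP=> /eqP fkE /orP[] /eqP kE; subst.
- by rewrite kE eqxx in fk.
- by right; rewrite eqxx andbT.
- by left; rewrite eqxx andbT.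
- by rewrite kE eqxx in fk.
Qed.

Let adj_max x y : adj E x y -> r y <= r x -> (x != ord0) && (f x == y).
Proof.
rewrite adjE => /orP[//|/andP[y0 /eqP <-]].
by rewrite leqNgt rf.
Qed.

(** Iterating [f] lowers [r] until the root is reached, whence connectedness. On a cycle of length
    above 2, both neighbours of a vertex [x] of maximal rank would equal [f x], a repetition. *)
Let E_tree : is_tree E.
Proof.
have conn0 x : connect (adj E) x ord0.
  have [m] := ubnP (r x); elim: m x => // m IHm x rx.
  have [-> //|x0] := eqVneq x ord0.
  apply: connect_trans (IHm (f x) (leq_trans (rf x0) rx)).
  by apply: connect1; rewrite adjE x0 eqxx.
apply/and3P; split.
- apply/'forall_implyP => _ /imsetP[k k0 ->]; rewrite cards2.
  by have := rf k0; case: (eqVneq k (f k)) => // <-; rewrite ltnn.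
- apply/forallP=> x; apply/forallP=> y; apply: connect_trans (conn0 x) _.
  by rewrite (sym_connect_sym (@adj_sym _ E)) conn0.
apply/forallP=> m; apply/forallP=> c; apply/implyP=> ucc.
rewrite -(size_tuple c).
case Ec : (tval c) => [//|x0 c0].
have x0c : x0 \in tval c by rewrite Ec mem_head.
case: (arg_maxnP r x0c) => x xc xmax.
have [i c' rotc] := rot_to xc; rewrite -Ec -(size_rot i) rotc.
move: ucc; rewrite /ucycleb -(rot_cycle i) -(rot_uniq i) rotc.
have {}xmax y : y \in x :: c' -> r y <= r x by rewrite -rotc mem_rot => /xmax.
case: c' xmax {rotc} => [//|y c']; case: (lastP c') => [//|c2 z] xmax.
rewrite /= !rcons_path last_rcons (adj_sym _ z).
move=> /andP[/and3P[xy _ xz] /and3P[_ yc _]].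
have /andP[_ /eqP fxy] : (x != ord0) && (f x == y).
  by apply: adj_max xy (xmax _ _); rewrite !inE eqxx orbT.
have /andP[_ /eqP fxz] : (x != ord0) && (f x == z).
  by apply: adj_max xz (xmax _ _); rewrite !inE mem_rcons mem_head !orbT.
by rewrite -fxy fxz mem_rcons mem_head in yc.
Qed.

(** Induction on rank: if the edge between [k] and [f k] were oriented the other way, the parent
    [f (f k)] of [f k] would be [k], although its rank is smaller. *)
Lemma tree_of_parent : exists T, forall k, k != ord0 -> parent T k = f k.
Proof.
exists (CayleyTree E_tree) => k; have [m] := ubnP (r k).
elim: m k => // m IHm k rk k0.
have /esym := adjE k (f k); rewrite k0 eqxx /= => adj_kfk.
have := adj_parentE (CayleyTree E_tree) k (f k).
rewrite /= -adj_kfk k0 => /esym/orP[/eqP //|/andP[fk0 /eqP]].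
rewrite IHm // ?(leq_trans (rf k0)) // => ffk.
by have := ltn_trans (rf fk0) (rf k0); rewrite ffk ltnn.
Qed.

End TreeOfParent.

(** * Priority-first search and the weary permutation *)

Lemma pfs_next_le T s x : x \notin s -> has (adj T x) s -> pfs_next T s <= x.
Proof.
rewrite /pfs_next => xs xadj; set F := (X in head _ X).
case EF: F => [|h t] /=.
  by have := in_nil x; rewrite -EF mem_filter xs xadj mem_enum.
have /ohead_filter_enum_ordP[_ ->] // : ohead F = Some h by rewrite EF.
by rewrite xs.
Qed.

(** The new vertex [v] has a visited neighbour [y]. It is the parent of [v]: if [v] were the parent
    of [y], it would have been visited already by induction. *)
Lemma pfs_parent T m x : m <= n -> x \in pfs T m -> parent T x \in pfs T m.
Proof.
elim: m x => [|m IHm] x mn; first by rewrite inE => /eqP->; rewrite parent0 inE.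
have /andP[s0 _] := uniq_pfs T (ltnW mn).
have /andP[] := @pfs_nextP _ T _ s0 (leq_trans (eq_leq (size_pfs T m)) mn).
rewrite /= !mem_rcons !inE => vNs /hasP[y ys].
rewrite adj_parentE => vy /predU1P[->|xs]; last by rewrite IHm ?orbT // ltnW.
case/orP: vy => /andP[_ /eqP E]; first by rewrite E ys orbT.
by rewrite -E IHm ?(ltnW mn) in vNs.
Qed.

Lemma pfs_prefix T m m' : m <= m' -> pfs T m = take m.+1 (pfs T m').
Proof.
elim: m' => [|m' IHm]; first by case: m.
rewrite leq_eqVlt => /predU1P[-> |mm']; first by rewrite take_oversize ?size_pfs.
by rewrite (IHm mm') /= -cats1 takel_cat // size_pfs.
Qed.

Lemma weary_pfs_next T k :
  k != ord0 -> weary T k = pfs_next T (pfs T k.-1).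
Proof.
rewrite permE /=; have := ltn_ord k; rewrite -val_eqE /= ltnS => kn k0.
rewrite -(nth_take ord0 (ltnSn k)) -pfs_prefix // -{1 2}(prednK (n := k)) ?lt0n //=.
by rewrite nth_rcons size_pfs ltnn eqxx.
Qed.

Lemma weary0 T : weary T ord0 = ord0.
Proof.
by rewrite permE /= -(nth_take ord0 (ltnSn 0)) -(pfs_prefix T (leq0n n)).
Qed.

Lemma mem_pfs T m x : m <= n -> (x \in pfs T m) = ((weary T)^-1%g x <= m).
Proof.
move=> mn; rewrite -{1}(permKV (weary T) x); move: (_ x) => i.
have /andP[_ u] := uniq_pfs T (leqnn n).
rewrite permE /= (pfs_prefix T mn) in_take ?mem_nth ?size_pfs //.
by rewrite index_uniq ?size_pfs // ltnS.
Qed.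

(* Priority-first search prefers the vertices x visited between the parent of k
   and k to the available vertex k. *)
Definition search_rank T (r : {perm 'I_n.+1}) : Prop :=
  r ord0 = ord0 /\
  forall k, k != ord0 -> r (parent T k) < r k /\
    forall x, r (parent T k) < r x -> r x < r k -> x < k.

Lemma perm_fix0 (r : {perm 'I_n.+1}) k :
  r ord0 = ord0 -> (r k == ord0) = (k == ord0).
Proof. by move=> r0; rewrite -{1}r0 (inj_eq perm_inj). Qed.

Lemma perm_fix0_gt0 (r : {perm 'I_n.+1}) k :
  r ord0 = ord0 -> (0 < r k) = (k != ord0).
Proof. by move=> r0; rewrite lt0n -(perm_fix0 k r0). Qed.

Lemma leq_perm_ltn (r : {perm 'I_n.+1}) x k : r x < r k -> x <= k -> x < k.
Proof.
move=> xk; rewrite [x <= k]leq_eqVlt => /predU1P[/val_inj E|//].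
by rewrite E ltnn in xk.
Qed.

(** [k] is reached from a visited neighbour, which is its parent because visited sets are closed
    under [parent]. Any [x] visited between the two was preferred to the available [k]. *)
Lemma weary_search_rank T : search_rank T (weary T)^-1%g.
Proof.
have r0 : (weary T)^-1%g ord0 = ord0 by apply: (canLR (permK _)); rewrite weary0.
set r := _^-1%g in r0 *; split=> // k k0.
have rE x : x != ord0 -> x = pfs_next T (pfs T (r x).-1).
  by move=> x0; rewrite -weary_pfs_next ?perm_fix0 // permKV.
have mem x y : y != ord0 -> (x \in pfs T (r y).-1) = (r x < r y).
  move=> y0; rewrite mem_pfs -/r ?(leq_trans (leq_pred _)) -1?ltnS //.
  by rewrite -[in RHS](prednK (n := r y)) // perm_fix0_gt0.
have rp : r (parent T k) < r k.
  rewrite -mem //; have kn : (r k).-1 < n.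
    by rewrite prednK ?perm_fix0_gt0 // -ltnS.
  have /andP[s0 _] := uniq_pfs T (ltnW kn).
  have /andP[] := @pfs_nextP _ T _ s0 (leq_trans (eq_leq (size_pfs T _)) kn).
  rewrite -rE // => kNs /hasP[y ys]; rewrite adj_parentE.
  case/orP=> /andP[_ /eqP E]; first by rewrite E.
  by have := pfs_parent (ltnW kn) ys; rewrite E (negPf kNs).
split=> // x px xk.
have x0 : x != ord0 by rewrite -(perm_fix0_gt0 x r0) (leq_ltn_trans _ px).
apply: (leq_perm_ltn xk); rewrite (rE x x0); apply: pfs_next_le.
  by rewrite mem // -leqNgt ltnW.
by apply/hasP; exists (parent T k); rewrite ?mem ?adj_parent.
Qed.

(** By induction on [m], the first [m.+1] visited vertices are those of [r]-rank at most [m]. This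
    identifies the weary permutation of a tree built from prescribed ranks. *)
Lemma search_rank_unique T r : search_rank T r -> r = (weary T)^-1%g.
Proof.
case=> r0 rT.
have memE m : m <= n -> forall x, (x \in pfs T m) = (r x <= m).
  elim: m => [_ x | m IHm mn x]; first by rewrite inE leqn0 -(perm_fix0 x r0).
  have {}IHm := IHm (ltnW mn); rewrite /= mem_rcons inE IHm.
  have s0 : ord0 \in pfs T m by rewrite IHm r0.
  have /andP[] := @pfs_nextP _ T _ s0 (leq_trans (eq_leq (size_pfs T _)) mn).
  set v := pfs_next T _; rewrite IHm -ltnNge => mv /hasP[y ys vy].
  have pv : r (parent T v) <= m.
    rewrite -IHm; move: vy; rewrite adj_parentE.
    case/orP=> /andP[_ /eqP E]; first by rewrite E.
    by have := pfs_parent (ltnW mn) ys; rewrite E IHm leqNgt mv.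
  suff rv : r v = m.+1 :> nat.
    by rewrite [RHS]leq_eqVlt ltnS -rv (inj_eq val_inj) (inj_eq perm_inj).
  apply/eqP; rewrite eqn_leq mv andbT leqNgt; apply/negP => mv1.
  have [z rz] : exists z, r z = m.+1 :> nat.
    by exists (r^-1%g (Ordinal (mn : m.+1 < n.+1))); rewrite permKV.
  have z0 : z != ord0 by rewrite -(perm_fix0_gt0 z r0) rz.
  have v0 : v != ord0 by rewrite -(perm_fix0_gt0 v r0) (leq_trans _ mv).
  (* [z] ranks between the parent of [v] and [v], so [z < v]. But [z] is available as well, so the
     search would not have chosen [v]. *)
  have [_ /(_ z)] := rT v v0; rewrite rz ltnS => /(_ pv mv1).
  rewrite ltnNge pfs_next_le ?IHm ?rz ?ltnn //.
  apply/hasP; exists (parent T z); last exact: adj_parent.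
  by have [+ _] := rT z z0; rewrite IHm rz.
apply/permP => x; apply/val_inj/eqP; rewrite eqn_leq /=.
by rewrite -memE ?mem_pfs -1?ltnS // leqnn -mem_pfs -1?ltnS // memE -1?ltnS // leqnn.
Qed.

Lemma tree_RecP T k : reflect
  (k != ord0 /\ forall x, (weary T)^-1%g x < (weary T)^-1%g k -> x < k)
  (k \in tree_Rec T).
Proof.
have [r0 rT] := weary_search_rank T; move: r0 rT; set r := _^-1%g => r0 rT.
(* Strong induction on the rank of [y]. If [x] comes after the parent of [y], then [y] was waiting
   and exceeds [x]; if before, the parent takes the place of [y]; otherwise [x] is that parent. *)
have rec x y : r x < r y -> exists2 z, z \in y :: root_path T y & x <= z.
  have [m] := ubnP (r y); elim: m y => // m IHm y ym xy.
  have y0 : y != ord0 by rewrite -(perm_fix0_gt0 y r0) (leq_ltn_trans _ xy).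
  have [py yP] := rT y y0.
  have [px | px | px] := ltngtP (r (parent T y)) (r x).
  - by exists y; rewrite ?mem_head // ltnW ?yP.
  - have [z zp xz] := IHm (parent T y) (leq_trans py ym) px.
    by exists z => //; rewrite root_pathE // inE zp orbT.
  exists x => //; rewrite root_pathE //.
  by rewrite (perm_inj (val_inj px)) !inE eqxx orbT.
have path_rank x y : y \in root_path T x -> r y < r x.
  have [m] := ubnP (r x); elim: m x => // m IHm x xm.
  have [-> | x0] := eqVneq x ord0; first by rewrite root_path0.
  have [px _] := rT x x0.
  rewrite root_pathE // inE => /predU1P[-> //|/IHm yp].
  exact: ltn_trans (yp (leq_trans px xm)) px.
rewrite inE; apply: (iffP andP) => -[k0 kP]; split=> //.
  move=> x xk; have [z zk xz] := rec x k xk.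
  apply: (leq_perm_ltn xk); apply: leq_trans xz _.
  move: zk; rewrite inE => /predU1P[-> //|].
  exact: (allP kP).
by apply/allP => y /path_rank /kP/ltnW.
Qed.

End Tree.

(** * Parking outcomes *)

Section Parking.
Variable n : nat.
Implicit Types (p : parking_function n) (a : seq 'I_n) (k i j : 'I_n).

Lemma park_SomeP s i j :
  park s i = Some j <->
  [/\ i <= j, Some j \notin s & forall k, i <= k -> k < j -> Some k \in s].
Proof.
split=> [/ohead_filter_enum_ordP[/andP[ij js] jmin] | [ij js jmin]].
  split=> // k ik; apply: contraTT => ks; rewrite -leqNgt jmin //.
  by rewrite ik ks.
apply/ohead_filter_enum_ordP; rewrite ij js; split=> // k /andP[ik].
by apply: contraNT; rewrite -ltnNge; apply: jmin.
Qed.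

Lemma outcome_rcons a i :
  outcome (rcons a i) = rcons (outcome a) (park (outcome a) i).
Proof. exact: foldl_rcons. Qed.

Lemma outcome_take a m : outcome (take m a) = take m (outcome a).
Proof.
elim/last_ind: a => // a i IHa; rewrite outcome_rcons -!cats1 !take_cat.
rewrite size_outcome; case: ltnP => // am.
case: (m - size a) => [|d] /=; first by rewrite !cats0.
by rewrite !cats1 outcome_rcons.
Qed.

Lemma mem_take_enum_ord m k : (k \in take m (enum 'I_n)) = (k < m).
Proof. by rewrite in_take ?mem_enum // index_enum_ord. Qed.

Lemma take_enum_ordS k :
  take k.+1 (enum 'I_n) = rcons (take k (enum 'I_n)) k.
Proof.
by rewrite (take_nth k) ?size_enum_ord // -[X in nth _ _ X]/(val k) nth_ord_enum.
Qed.

Lemma spotE p k : nth None (outcome p) k = Some (spot p k).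
Proof.
rewrite permE /spot_fun; case E: (nth _ _ _) => [//|].
have /negP[] := prefs_parking p.
by rewrite -E mem_nth // size_outcome size_tuple.
Qed.

Lemma outcomeE p : outcome p = [seq Some (spot p k) | k <- enum 'I_n].
Proof.
apply: (@eq_from_nth _ None) => [|m].
  by rewrite size_map size_enum_ord size_outcome size_tuple.
rewrite size_outcome size_tuple => mn; rewrite (spotE p (Ordinal mn)).
by rewrite (nth_map (Ordinal mn)) ?size_enum_ord // (nth_ord_enum _ (Ordinal mn)).
Qed.

(** The outcome of a prefix is a prefix of the outcome, so when car [k] enters, the occupied spots
    are exactly those of the cars below [k]. *)
Lemma spot_bounds p k :
  tnth p k <= spot p k /\
  forall k', tnth p k <= spot p k' -> spot p k' < spot p k -> k' < k.
Proof.
have E : park (outcome (take k p)) (tnth p k) = Some (spot p k).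
  have := outcome_rcons (take k p) (tnth p k).
  rewrite (tnth_nth k) -take_nth ?size_tuple // => /(congr1 (last None)).
  rewrite last_rcons => <-; rewrite outcome_take.
  by rewrite (take_nth None) ?size_outcome ?size_tuple // last_rcons spotE.
have [ak _ occ] := (park_SomeP _ _ _).1 E; split=> // k' ak' k'k.
have := occ _ ak' k'k; rewrite outcome_take outcomeE -map_take.
rewrite mem_map ?mem_take_enum_ord // => x y [] /perm_inj //.
Qed.

(** Converse of [spot_bounds], by induction on the number of cars entered: the spots from [tnth a k]
    to just before [s k] are held by earlier cars, and [s k] is free because [s] is injective. *)
Lemma parking_of_spot (a : n.-tuple 'I_n) (s : {perm 'I_n}) :
    (forall k, tnth a k <= s k) ->
    (forall k k', tnth a k <= s k' -> s k' < s k -> k' < k) ->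
  exists p, prefs p = a /\ spot p = s.
Proof.
move=> a_s occ.
have outE m : m <= n ->
    outcome (take m a) = [seq Some (s k) | k <- take m (enum 'I_n)].
  elim: m => [|m IHm] mn; first by rewrite !take0.
  pose k := Ordinal mn.
  rewrite (take_nth k) ?size_tuple // (take_enum_ordS k) outcome_rcons map_rcons.
  rewrite (IHm (ltnW mn)) -(tnth_nth k a k); congr rcons; apply/park_SomeP.
  have s_inj : injective (fun k => Some (s k)) by move=> x y [] /perm_inj.
  split=> // [|j aj jk]; first by rewrite mem_map // mem_take_enum_ord ltnn.
  rewrite -(permKV s j) in aj jk *.
  by rewrite mem_map // mem_take_enum_ord; apply: occ aj jk.
have {}outE : outcome a = [seq Some (s k) | k <- enum 'I_n].
  by have := outE n (leqnn n); rewrite !take_oversize ?size_enum_ord ?size_tuple.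
have parking_a : is_parking a by rewrite /is_parking outE; apply/mapP => -[].
exists (ParkingFunction parking_a); split=> //; apply/permP => k.
have := spotE (ParkingFunction parking_a) k; rewrite /= outE.
by rewrite (nth_map k) ?size_enum_ord // nth_ord_enum => -[].
Qed.

End Parking.

(** * The correspondence between trees and parking functions *)

Section Correspondence.
Variable n : nat.
Implicit Types (T : cayley_tree n) (p : parking_function n) (k : 'I_n).

(* The i-th visited vertex drives the car parked in spot i, and its parent, if
   visited j-th (the root being 0-th), gives the preference j + 1, which the
   shifted labels of cars and spots turn into j. *)
Definition corresponds T p : Prop :=
  forall k, (weary T)^-1%g (lift ord0 k) = lift ord0 (spot p k) /\
    (weary T)^-1%g (parent T (lift ord0 k)) = tnth p k :> nat.

Lemma wearyV0 T : (weary T)^-1%g ord0 = ord0.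
Proof. by have [] := weary_search_rank T. Qed.

Lemma corresponds_parking T : exists p, corresponds T p.
Proof.
have [r0 rT] := weary_search_rank T; move: r0 rT; rewrite /corresponds.
set r := _^-1%g => r0 rT.
have lift_neq0 k : lift ord0 k != ord0 by rewrite eq_sym neq_lift.
have /fin_all_exists[s rs] k : exists j, r (lift ord0 k) = lift ord0 j.
  have [j ->|/eqP] := unliftP ord0 (r (lift ord0 k)); first by exists j.
  by rewrite perm_fix0 // (negPf (lift_neq0 k)).
have /fin_all_exists[a ra] k :
    exists j : 'I_n, r (parent T (lift ord0 k)) = j :> nat.
  have [ap _] := rT _ (lift_neq0 k).
  by exists (Ordinal (leq_trans ap (ltn_ord (r (lift ord0 k))))).
have s_inj : injective s.
  move=> j k /(congr1 (lift ord0)); rewrite -!rs => /perm_inj.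
  exact: lift_inj.
have [|k k'|p [pa ps]] := @parking_of_spot n [tuple a k | k < n] (perm s_inj).
(* [lift ord0] adds 1, so a parent ranking strictly before its child becomes a preference at most
   equal to the spot. *)
- move=> k; rewrite tnth_mktuple permE -ra -ltnS -[(s k).+1]/(val (lift ord0 (s k))).
  by rewrite -rs; have [] := rT _ (lift_neq0 k).
- rewrite tnth_mktuple !permE -ra => ak kk.
  have [_ /(_ (lift ord0 k'))] := rT _ (lift_neq0 k).
  by rewrite !rs; apply.
exists p => k; rewrite ps pa (permE s_inj) tnth_mktuple.
by rewrite -rs ra.
Qed.

(** The prescribed rank [r] decreases along the prescribed parent map [f], so [f] comes from a tree.
    [spot_bounds] makes [r] a search rank of it, and uniqueness identifies [r] with the inverse
    weary permutation. *)
Lemma corresponds_tree p : exists T, corresponds T p.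
Proof.
pose r := lift_perm ord0 ord0 (spot p).
have r0 : r ord0 = ord0 by rewrite lift_perm_id.
have rl k : r (lift ord0 k) = lift ord0 (spot p k) by rewrite lift_perm_lift.
pose f x := if unlift ord0 x is Some k
  then r^-1%g (widen_ord (leqnSn n) (tnth p k)) else ord0.
have fl k : r (f (lift ord0 k)) = tnth p k :> nat by rewrite /f liftK permKV.
have rf x : x != ord0 -> r (f x) < r x.
  have [k -> _|-> /eqP//] := unliftP ord0 x.
  by rewrite fl rl ltnS; have [] := spot_bounds p k.
have [T parT] := @tree_of_parent n f (fun x => r x) rf.
have lift_neq0 k : lift ord0 k != ord0 by rewrite eq_sym neq_lift.
exists T => k; have <- : r = (weary T)^-1%g; last by rewrite parT ?rl ?fl.
apply: search_rank_unique; split=> // x x0; rewrite parT //.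
split=> [|y]; first exact: rf.
have [j ->|->] := unliftP ord0 y; last by rewrite r0 ltn0.
have [i ->|x0'] := unliftP ord0 x; last by rewrite x0' in x0.
rewrite fl !rl !ltnS => ai ji.
by have [_ /(_ j)] := spot_bounds p i; apply.
Qed.

Lemma corresponds_inj_tree T T' p :
  corresponds T p -> corresponds T' p -> T = T'.
Proof.
move=> Tp T'p; have wE : (weary T)^-1%g = (weary T')^-1%g.
  apply/permP => x; have [k ->|->] := unliftP ord0 x; last by rewrite !wearyV0.
  by rewrite (Tp k).1 (T'p k).1.
apply: parent_inj => x; have [k -> _|-> /eqP//] := unliftP ord0 x.
apply: (@perm_inj _ (weary T)^-1%g); apply: val_inj.
by rewrite /= (Tp k).2 wE (T'p k).2.
Qed.

Lemma corresponds_inj_parking T p p' :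
  corresponds T p -> corresponds T p' -> p = p'.
Proof.
move=> Tp Tp'; apply: val_inj; apply: eq_from_tnth => k; apply: val_inj.
by rewrite /= -(Tp k).2 (Tp' k).2.
Qed.

Lemma parent_priority_tree T x :
  parent (priority_tree T) ((weary T)^-1%g x) = (weary T)^-1%g (parent T x).
Proof. by apply: parent_relabel => //; apply: wearyV0. Qed.

(** * Comparison of the statistics *)

Section Hexads.
Variables (T : cayley_tree n) (p : parking_function n).
Hypothesis Tp : corresponds T p.

Let rl k : (weary T)^-1%g (lift ord0 k) = lift ord0 (spot p k).
Proof. by case: (Tp k). Qed.

Let rp k : (weary T)^-1%g (parent T (lift ord0 k)) = tnth p k :> nat.
Proof. by case: (Tp k). Qed.

Let ptl k :
  parent (priority_tree T) (lift ord0 (spot p k)) = tnth p k :> nat.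
Proof. by rewrite -rl parent_priority_tree rp. Qed.

Lemma corresponds_Rec : tree_Rec T = parking_Rec p.
Proof.
apply/setP => x; apply/tree_RecP/imsetP => [[x0 xmax] | [j]].
  have [k xk|x_0] := unliftP ord0 x; last by rewrite x_0 in x0.
  exists (spot p k); last by rewrite permK.
  rewrite inE permK; apply/forallP => i; apply/implyP => ik.
  have := xmax (lift ord0 (birds_eye p i)).
  by rewrite xk !rl permKV !lift0 !ltnS; apply.
rewrite inE => /forallP jmax ->; split; first by rewrite eq_sym neq_lift.
move=> y; have [k ->|-> //] := unliftP ord0 y.
rewrite !rl permKV !lift0 !ltnS => kj.
by have /implyP/(_ kj) := jmax (spot p k); rewrite permK.
Qed.

Lemma corresponds_wait : wait T = probes p.
Proof.
rewrite /wait big_mkcond big_ord_recl eqxx /= add0n /probes /dis.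
(* [n] is spread as 1 per car, matching the shift by 1 between a rank and the ['I_n] label of a
   spot. *)
rewrite -[X in _ + X]card_ord -sum1_card -big_split /=.
rewrite (reindex_inj (@perm_inj _ (spot p))) /=; apply: eq_bigr => k _.
by rewrite ptl /bump add1n subSn ?addn1 //; have [] := spot_bounds p k.
Qed.

Lemma corresponds_psa : psa T = lucky p.
Proof.
have sl_inj := inj_comp (@lift_inj _ ord0) (@perm_inj _ (spot p)).
rewrite /psa /lucky -[RHS](card_imset _ sl_inj); apply: eq_card => x; rewrite inE.
have [j ->|->] := unliftP ord0 x; last first.
  rewrite eqxx; apply/esym/imsetP => -[k _ /eqP].
  by rewrite (negPf (neq_lift _ _)).
rewrite -(permKV (spot p) j) eq_sym neq_lift ptl lift0 eq_sym.
by rewrite (mem_imset _ _ sl_inj) inE.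
Qed.

(** Non-root vertices are cars and ranks of parents are shifted preferences. The root degree and the
    child sequence both reduce to this count. *)
Let card_children v :
  #|children T v| = #|[set k | tnth p k == (weary T)^-1%g v :> nat]|.
Proof.
rewrite -[RHS](card_imset _ (@lift_inj _ ord0)); apply: eq_card => x.
rewrite inE; have [k -> |->] := unliftP ord0 x; last first.
  rewrite eqxx; apply/esym/imsetP => -[k _ /eqP].
  by rewrite (negPf (neq_lift _ _)).
rewrite eq_sym neq_lift mem_imset ?inE; last exact: lift_inj.
by rewrite -rp (inj_eq val_inj) (inj_eq perm_inj).
Qed.

Lemma corresponds_deg_root : deg_root T = ones p.
Proof. by rewrite /deg_root card_children wearyV0. Qed.

Lemma corresponds_chseq : chseq T = mult p.
Proof.
apply: eq_from_tnth => i; rewrite !tnth_mktuple.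
(* Vertices are reindexed by rank, rank [j] standing for the element [j + 1] of [[n + 1]] in
   [mult]. *)
rewrite -[LHS](card_imset _ (@perm_inj _ (weary T)^-1%g)); apply: eq_card => j.
rewrite -{1}(permK (weary T) j) mem_imset ?inE; last exact: perm_inj.
rewrite card_children permK cardsE cardE size_filter.
by rewrite -[X in _ = (count _ X == _)]map_tnth_enum count_map enumT.
Qed.

Lemma corresponds_hexad : tree_hexad T = parking_hexad p.
Proof.
rewrite /tree_hexad /parking_hexad corresponds_Rec corresponds_wait.
by rewrite corresponds_psa corresponds_deg_root corresponds_chseq.
Qed.

End Hexads.

End Correspondence.

Theorem theorem4p1 (n : nat) (v : hexad n) :
  #|[set T : cayley_tree n | tree_hexad T == v]| =
  #|[set p : parking_function n | parking_hexad p == v]|.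
Proof.
have /fin_all_exists[F FP] := @corresponds_parking n.
have F_inj : injective F.
  move=> T T' FTT'; apply: corresponds_inj_tree (FP T) _.
  by rewrite FTT'; apply: FP.
rewrite -(card_imset _ F_inj); apply: eq_card => p.
have [T Tp] := corresponds_tree p.
(* [F] is onto: the tree [T] obtained from [p] satisfies [F T = p], since only one parking function
   corresponds to [T]. *)
rewrite -(corresponds_inj_parking (FP T) Tp) mem_imset // !inE.
by rewrite (corresponds_hexad (FP T)).
Qed.
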